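(* A natural number $n$ is an ACLT number if and only if one of the following conditions holds: (1) $n$ is an abelian number; (2) $n=pq$, where $p<q$ are primes and $p\mid q-1$; (3) $n=p^m$, where $p$ is a prime and $m\in\{0,1,2,3,4\}$; (4) $n=p^2q$, where $p$ and $q$ are distinct primes with $p\mid q-1$ and $p^2\nmid q-1$, and $n\neq 12$.
   Context: All groups are finite and natural numbers are positive integers. A finite group $G$ is an ACLT (Abelian CLT) group if for every proper divisor $d$ of $|G|$ (positive divisor $d\neq |G|$), $G$ contains an abelian subgroup of order $d$. A natural number $n$ is an ACLT number if every group of order $n$ is an ACLT group. A natural number $n$ is an abelian number if every group of order $n$ is abelian. *)

(* Defs.v *)
From mathcomp Require Import all_boot all_fingroup.

Set Implicit Arguments.
Unset Strict Implicit.
Unset Printing Implicit Defensive.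

Definition aclt_group (gT : finGroupType) (G : {group gT}) : Prop :=
  forall d : nat, d %| #|G| -> d <> #|G| ->
    exists A : {group gT}, [/\ A \subset G, abelian A & #|A| = d].

Definition aclt_number (n : nat) : Prop :=
  forall (gT : finGroupType) (G : {group gT}), #|G| = n -> aclt_group G.

Definition abelian_number (n : nat) : Prop :=
  forall (gT : finGroupType) (G : {group gT}), #|G| = n -> abelian G.

(* Main.v *)
Require Import Defs.
From mathcomp Require Import all_boot all_fingroup all_solvable all_algebra.
From mathcomp Require Import finfield mxabelem.

(** A group is an ACLT group exactly when, for every prime [r] dividing its
    order, it has an abelian subgroup of index [r]: every proper divisor of
    [#|G|] divides some [#|G| %/ r], and an abelian group has subgroups of all
    orders dividing its own.

    Necessity rests on one remark. If [p <> q] are primes dividing the order of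
    an ACLT group [G], abelian subgroups [A] of index [p] and [B] of index [q]
    have coprime indices, so [G = A * B] and [A :&: B] is central of index
    [p * q]. Hence the index of the centre of [G] divides [p * q]
    ([aclt_center_index]). If [n] is an ACLT number, this applies to [H x C] for
    every group [H] of order dividing [n] and [C] cyclic of the complementary
    order, hence bounds [#|H : 'Z(H)|] too ([aclt_number_center_index]).
    - With three distinct primes [p], [q], [r] dividing [n], the index of the
      centre divides both [p * q] and [p * r], so it divides [p], the central
      quotient is cyclic, and every group of order [n] is abelian.
    - If [n = p ^ a * q ^ b] and neither prime divides the other minus one, the
      central quotient, of order dividing [p * q], is again cyclic.
    - If [n = p ^ a * q ^ b] with [p %| q - 1], suitable groups [H] with a large
      central index restrict [a] and [b] ([aclt_number_paqb]): the
      extraspecial group of order [p ^ 3] forces [a <= 2], and centreless groups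
      [F ><| U], where [F] is a finite field and [U] a group of units, force
      [b = 1] ([F] of order [q ^ 2], [U] of order [p]), then
      [~~ (p ^ 2 %| q - 1)] when [a = 2] ([F] of order [q], [U] of order
      [p ^ 2]), and finally [n <> 12] ([F] of order 4, [U] of order 3; this is
      the alternating group of degree 4).
    - If [n = p ^ m] with [m > 4], the product of an extraspecial group of order
      [p ^ 5] and a cyclic group has no abelian subgroup of index [p].

    Sufficiency is a search for abelian subgroups of prime index. In a group of
    order [p ^ 4] the centraliser of a normal subgroup of order [p ^ 2] has
    index at most [p], and yields an abelian subgroup of index [p]
    ([p4group_abelian_p3]). In a group of order [p ^ 2 * q <> 12] with
    [p %| q - 1] and [~~ (p ^ 2 %| q - 1)], the Sylow [q]-subgroup is normal and its centraliser has index at most [p]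
    because [p ^ 2] does not divide the order of its automorphism group
    ([aclt_p2q]). *)

Set Implicit Arguments.
Unset Strict Implicit.
Unset Printing Implicit Defensive.

Local Open Scope group_scope.

(** * Abelian subgroups of prime index *)

(** Induction on [d]: with [p] a prime factor of [d], Cauchy's theorem gives a
    subgroup of order [p], normal since [G] is abelian, and a subgroup of order
    [d %/ p] of the quotient pulls back to one of order [d]. *)
Lemma abelian_subgroup_of_order (gT : finGroupType) (G : {group gT}) d :
  abelian G -> d %| #|G| -> exists2 A : {group gT}, A \subset G & #|A| = d.
Proof.
have [m] := ubnP d; elim: m => // m IHm in gT G d *; rewrite ltnS => le_d_m cGG.
have [d_le1 dG | d_gt1 dG] := leqP d 1.
  have d_gt0 := dvdn_gt0 (cardG_gt0 G) dG; exists 1%G; first exact: sub1G.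
  by rewrite cards1; apply/eqP; rewrite eqn_leq d_gt0 d_le1.
have pr_p := pdiv_prime d_gt1; set p := pdiv d in pr_p.
have p_d : p %| d := pdiv_dvd d.
have [x Gx ox] := Cauchy pr_p (dvdn_trans p_d dG).
have sXG : <[x]> \subset G by rewrite cycle_subG.
have nXG : <[x]> <| G by rewrite -sub_abelian_normal.
have oX : #|<[x]>| = p by rewrite -orderE.
have [|||B sBG oB] := IHm _ (G / <[x]>)%G (d %/ p).
- by apply: leq_trans le_d_m; rewrite ltn_Pdiv ?prime_gt1 // ltnW.
- exact: quotient_abelian.
- rewrite card_quotient ?normal_norm // -(dvdn_pmul2l (prime_gt0 pr_p)).
  by rewrite mulnC divnK // -[in X in _ %| X]oX Lagrange.
have [A defA sXA sAG] := inv_quotientS nXG sBG.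
exists A => //; rewrite -(Lagrange sXA) -card_quotient; last first.
  exact: subset_trans sAG (normal_norm nXG).
by rewrite -defA oB oX mulnC divnK.
Qed.

(** Only the maximal proper divisors [#|G| %/ r] matter, as the smaller ones are
    reached inside the corresponding abelian subgroups. *)
Lemma aclt_groupP (gT : finGroupType) (G : {group gT}) :
  aclt_group G <-> forall r, prime r -> r %| #|G| ->
    exists A : {group gT}, [/\ A \subset G, abelian A & #|G : A| = r].
Proof.
split=> [acltG r pr_r rG | max_ab d dG /eqP neq_dG].
  have [||A [sAG cAA oA]] := acltG (#|G| %/ r).
  - exact: dvdn_div.
  - by apply/eqP; rewrite neq_ltn ltn_Pdiv ?prime_gt1 ?cardG_gt0.
  by exists A; split=> //; rewrite -divgS // oA divnA // mulKn.
have Gd_gt1 : 1 < #|G| %/ d.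
  rewrite ltn_divRL // mul1n ltn_neqAle neq_dG.
  by rewrite dvdn_leq ?cardG_gt0.
set r := pdiv (#|G| %/ d); have pr_r : prime r := pdiv_prime Gd_gt1.
have r_dv : (r * d)%N %| #|G| by rewrite -dvdn_divRL // pdiv_dvd.
have [A [sAG cAA iA]] := max_ab r pr_r (dvdn_trans (dvdn_mulr d (dvdnn r)) r_dv).
have [|B sBA oB] := @abelian_subgroup_of_order _ A d cAA.
  have oG : #|G| = (r * #|A|)%N by rewrite -(Lagrange sAG) iA mulnC.
  by rewrite -(dvdn_pmul2l (prime_gt0 pr_r)) -oG.
by exists B; split=> //; [apply: subset_trans sBA sAG | apply: abelianS sBA cAA].
Qed.

(** Each of two abelian subgroups that generate [G] centralises their
    intersection. *)
Lemma aclt_center_index (gT : finGroupType) (G : {group gT}) p q :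
  prime p -> prime q -> p != q -> p %| #|G| -> q %| #|G| -> aclt_group G ->
  #|G : 'Z(G)| %| p * q.
Proof.
move=> pr_p pr_q neq_pq pG qG /aclt_groupP max_ab.
have [A [sAG cAA iA]] := max_ab p pr_p pG.
have [B [sBG cBB iB]] := max_ab q pr_q qG.
have copq : coprime #|G : A| #|G : B| by rewrite iA iB prime_coprime ?dvdn_prime2.
have defG := coprime_index_mulG sAG sBG copq.
have sABZ : A :&: B \subset 'Z(G).
  rewrite subsetI (subset_trans (subsetIl A B)) //= -defG centM subsetI.
  by rewrite (subset_trans (subsetIl A B)) ?(subset_trans (subsetIr A B)).
apply: dvdn_trans (_ : #|G : A :&: B| %| _); first exact: indexgS.
rewrite -(Lagrange_index sAG (subsetIl A B)) iA dvdn_pmul2l ?prime_gt0 //.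
by rewrite indexgI -indexMg (coprime_index_mulG sBG sAG) ?iB // coprime_sym -iB.
Qed.

(** * Centreless affine groups over finite fields *)

(** Units of the field [F] of order [q ^ k] act freely on the nonzero elements of
    [F], by multiplication. So in [F ><| U] an element centralising [F] lies in
    [F], and a nonzero element of [F] does not commute with a nontrivial unit.
    The additive group of [F] appears as ['M[F]_1], on which the scaling action
    is a group action. *)
Lemma affine_centerless (q k u : nat) :
  prime q -> 0 < k -> 1 < u -> u %| (q ^ k).-1 ->
  exists (gT : finGroupType) (H : {group gT}), #|H| = (q ^ k * u)%N /\ 'Z(H) = 1.
Proof.
move=> pr_q k_gt0 u_gt1 u_dv.
have [F _ oF] := pPrimePowerField pr_q k_gt0.
have [||U _ oU] := @abelian_subgroup_of_order _ [set: {unit F}]%G u.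
- exact/cyclic_abelian/field_unit_group_cyclic.
- by rewrite /= card_finField_unit oF.
pose to := scale_groupAction F 1 1.
pose V := (sdpair1 to @* setT)%G; pose W := (sdpair2 to @* U)%G.
have tiVW : V :&: W = 1.
  by apply/trivgP; rewrite -(im_sdpair_TI to) setIS ?morphimS ?subsetT.
have nVW : W \subset 'N(V).
  by apply: subset_trans (im_sdpair_norm to); rewrite morphimS ?subsetT.
have free_act (x : 'M[F]_1) a :
  x != 0%R -> commute (sdpair1 to x) (sdpair2 to a) -> a = 1.
  move=> nz_x /commgP/conjg_fixP cxa; apply/set1gP.
  rewrite -(astab1_scale_act nz_x); apply/astab1P; rewrite ?inE //.
  apply: (injmP (injm_sdpair1 to)); rewrite ?inE //.
  by have := @sdpair_act _ _ _ _ to x a (in_setT x) (in_setT a); rewrite cxa.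
exists _, (V <*> W)%G; split.
  rewrite /= norm_joinEr ?TI_cardMg //= !card_injm ?injm_sdpair1 ?injm_sdpair2 ?subsetT //.
  by rewrite cardsT card_mx oF oU muln1.
apply/trivgP/subsetP=> z /setIP[_ cGz]; rewrite inE.
have [cVz cWz] : z \in 'C(V) /\ z \in 'C(W).
  by apply/andP; rewrite -in_setI -centY.
have z2V : sdpair1 to z.2 \in V by rewrite mem_morphim ?inE.
have defz := sdpairE z.
have cVV : abelian V by apply/morphim_abelian/FinRing.zmod_abelian.
(* As [z] and [sdpair1 to z.2] centralise the abelian group [V], so does
   [sdpair2 to z.1], which must fix the matrix [1%:M]. *)
have z1 : z.1 = 1.
  apply: (free_act 1%:M%R); first by rewrite -mxrank_eq0 mxrank1.
  have xV : sdpair1 to 1%:M%R \in V by rewrite mem_morphim ?inE.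
  have -> : sdpair2 to z.1 = z * (sdpair1 to z.2)^-1 by rewrite {2}defz mulgK.
  apply: commuteM; first exact/commute_sym/(centP cVz).
  by apply: commuteV; apply: (centsP cVV).
have [a Ua nt_a] : exists2 a, a \in U & a != 1.
  by apply/trivgPn; rewrite -cardG_gt1 oU.
rewrite defz z1 morph1 mul1g.
have [-> | nz_z2] := eqVneq z.2 0%R; first by rewrite morph1.
case/eqP: nt_a; apply: (free_act _ _ nz_z2).
have -> : sdpair1 to z.2 = z by rewrite [RHS]defz z1 morph1 mul1g.
by apply: (centP cWz); rewrite mem_morphim ?inE.
Qed.

(** * Central index and ACLT numbers *)

(** The first projection is onto and maps the centre into the centre. *)
Lemma center_index_setX (gT rT : finGroupType) (H : {group gT}) (C : {group rT}) :
  #|H : 'Z(H)| %| #|setX H C : 'Z(setX H C)|.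
Proof.
pose f := [morphism of fun x : gT * rT => x.1].
have fG : f @* setX H C = H by apply: morphim_fstX.
rewrite -[in X in X %| _]fG.
have fZ : f @* 'Z(setX H C) \subset 'Z(f @* setX H C) by apply: morphim_center.
apply: dvdn_trans (indexgS [group of f @* setX H C] fZ) _.
by apply: index_morphim; apply: subsetT.
Qed.

(** Multiplying [H] by a cyclic group of order [n %/ #|H|] turns a group of order
    dividing [n] into one of order [n]. *)
Lemma aclt_number_center_index n p q (gT : finGroupType) (H : {group gT}) :
  0 < n -> prime p -> prime q -> p != q -> p %| n -> q %| n -> #|H| %| n ->
  aclt_number n -> #|H : 'Z(H)| %| p * q.
Proof.
move=> n_gt0 pr_p pr_q neq_pq pn qn Hn acltn.
pose C := [group of Zp (n %/ #|H|)].
have oC : #|C| = n %/ #|H| by rewrite card_Zp // divn_gt0 // dvdn_leq.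
pose G := [group of setX H C].
have oG : #|G| = n by rewrite cardsX oC mulnC divnK.
apply: dvdn_trans (center_index_setX H C) _.
by apply: (@aclt_center_index _ G) (acltn _ _ oG); rewrite ?oG.
Qed.

(** * Prime powers that are not ACLT numbers *)

(** In an extraspecial group the commutator pairing on the central quotient is
    nondegenerate, so the centraliser of [B] has order [#|'Z(E) :&: B| * #|E : B|];
    an abelian [B] lies in it. *)
Lemma card_abelian_extraspecial (gT : finGroupType) (E B : {group gT}) (p : nat) :
  p.-group E -> extraspecial E -> B \subset E -> abelian B ->
  #|B| ^ 2 <= #|'Z(E)| * #|E|.
Proof.
move=> pE esE sBE cBB.
have leB : #|B| <= #|'Z(E)| * #|E : B|.
  apply: leq_trans (subset_leq_card (_ : B \subset 'C_E(B))) _.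
    by rewrite subsetI sBE.
  rewrite (card_subcent_extraspecial pE esE sBE).
  by rewrite leq_mul2r subset_leq_card ?subsetIl ?orbT.
by rewrite -(Lagrange sBE) mulnCA expnS expn1 leq_pmul2l ?cardG_gt0.
Qed.

(** An abelian subgroup [A] of index [p] in [E x C], with [E] extraspecial of
    order [p ^ 5], projects onto an abelian subgroup of [E] of order at least
    [p ^ 4], while abelian subgroups of [E] have order at most [p ^ 3]. *)
Lemma aclt_prime_power p m : prime p -> aclt_number (p ^ m)%N -> m <= 4.
Proof.
move=> pr_p acltn; rewrite leqNgt; apply/negP=> m_gt4.
pose E := (p^{1+2*2})%G; pose C := [group of Zp (p ^ (m - 5))].
have oE : #|E| = (p ^ 5)%N := card_pX1p2n 2 pr_p.
have pE : p.-group E := pX1p2n_pgroup 2 pr_p.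
have esE : extraspecial E := pX1p2n_extraspecial pr_p (isT : 0 < 2).
have oC : #|C| = (p ^ (m - 5))%N by rewrite card_Zp // expn_gt0 prime_gt0.
pose G := [group of setX E C].
have oG : #|G| = (p ^ m)%N by rewrite cardsX oE oC -expnD subnKC.
have /aclt_groupP/(_ p pr_p) := acltn _ G oG.
case=> [|A [sAG cAA iA]].
  by rewrite oG dvdn_exp // (leq_trans _ m_gt4).
pose B := ([morphism of fun x => x.1] @* A)%G.
have cBB : abelian B by apply: morphim_abelian.
have sAX : A \subset setX B C.
  apply/subsetP=> x Ax; have := subsetP sAG x Ax; rewrite inE => /andP[_ x2C].
  by rewrite inE x2C andbT; apply: (mem_morphim [morphism of fun x => x.1]) => //; rewrite inE.
have leB : p ^ 4 <= #|B|.
  have := subset_leq_card sAX; rewrite cardsX oC.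
  have -> : #|A| = (p ^ 4 * p ^ (m - 5))%N.
    have := Lagrange sAG; rewrite iA oG => oA.
    apply/eqP; rewrite -(eqn_pmul2r (prime_gt0 pr_p)) oA.
    by rewrite -expnD -expnSr -addSn subnKC.
  by rewrite leq_pmul2r ?expn_gt0 ?prime_gt0.
have := card_abelian_extraspecial pE esE (subsetT B) cBB.
rewrite (card_center_extraspecial pE esE) oE -expnS leqNgt => /negP[].
have /leq_trans-> // : p ^ 6 < (p ^ 4) ^ 2 by rewrite -expnM ltn_exp2l ?prime_gt1.
by rewrite leq_exp2r.
Qed.

(** * Groups of order dividing a product of two primes *)

Lemma dvd_pred_prime_ltn p q : prime p -> prime q -> p %| q - 1 -> p < q.
Proof.
move=> pr_p pr_q /dvdn_leq; rewrite subn_gt0 prime_gt1 // => /(_ isT) le_pq.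
by apply: leq_ltn_trans le_pq _; rewrite ltn_subrL /= prime_gt0.
Qed.

(** The number of Sylow [p]-subgroups is prime to [p], so divides [q], and it is 1
    modulo [p]; it is not [q], as [p] does not divide [q - 1]. *)
Lemma normal_Sylow_pq (gT : finGroupType) (X P : {group gT}) p q :
  prime p -> prime q -> #|X| %| p * q -> ~~ (p %| q - 1) ->
  p.-Sylow(X) P -> P <| X.
Proof.
move=> pr_p pr_q Xpq npq sylP.
have k_p := card_Syl_mod X pr_p; have k_dv := dvdn_trans (card_Syl_dvd p X) Xpq.
set k := #|'Syl_p(X)| in k_p k_dv.
have copk : coprime k p.
  by rewrite coprime_sym prime_coprime // /dvdn k_p.
have : k %| q by rewrite -(Gauss_dvdr q copk).
case/primeP: (pr_q) => _ kq /kq /orP[/eqP k1 | /eqP kq']; last first.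
  case/negP: npq; rewrite -eqn_mod_dvd ?prime_gt0 // -kq' k_p.
  by rewrite modn_small ?prime_gt1.
have /eqP := k1; rewrite /k (card_Syl sylP) indexg_eq1 subsetI subxx /= => nP.
by rewrite /normal (pHall_sub sylP).
Qed.

(** Both Sylow subgroups are normal, so [X] is the direct product of two groups of
    coprime orders, each of order 1 or prime. *)
Lemma cyclic_dvd_pq (gT : finGroupType) (X : {group gT}) p q :
  prime p -> prime q -> p != q -> #|X| %| p * q ->
  ~~ (p %| q - 1) -> ~~ (q %| p - 1) -> cyclic X.
Proof.
move=> pr_p pr_q neq_pq Xpq np nq.
have [P sylP] := Sylow_exists p X; have [Q sylQ] := Sylow_exists q X.
have nP := normal_Sylow_pq pr_p pr_q Xpq np sylP.
have nQ : Q <| X by apply: (normal_Sylow_pq pr_q pr_p) sylQ; rewrite 1?mulnC.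
have iP : #|X : P| %| q.
  rewrite -(@Gauss_dvdr _ p).
    by apply: dvdn_trans Xpq; apply: dvdn_indexg.
  by rewrite coprime_sym prime_coprime // -p'natE //; case/and3P: sylP.
have iQ : #|X : Q| %| p.
  rewrite -(@Gauss_dvdl _ _ q).
    by apply: dvdn_trans Xpq; apply: dvdn_indexg.
  by rewrite coprime_sym prime_coprime // -p'natE //; case/and3P: sylQ.
have sPX := pHall_sub sylP; have sQX := pHall_sub sylQ.
have defX : P * Q = X.
  apply: coprime_index_mulG => //; rewrite coprime_sym.
  by apply: coprime_dvdl iQ (coprime_dvdr iP _); rewrite prime_coprime // dvdn_prime2.
have cop : coprime #|P| #|Q|.
  apply: pnat_coprime (pHall_pgroup sylP) _.
  by apply: pi_pnat (pHall_pgroup sylQ) _; rewrite !inE eq_sym.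
have cycS r (R : {group gT}) : prime r -> #|R| %| r -> cyclic R.
  move=> pr_r; case/primeP: (pr_r) => _ dv_r /dv_r /orP[/eqP R1 | /eqP oR].
    by rewrite (card1_trivg R1) cyclic1.
  by rewrite prime_cyclic // oR.
have [oP oQ] : #|P| %| p /\ #|Q| %| q.
  split.
    rewrite -(@Gauss_dvdl _ _ q) ?(dvdn_trans (cardSg sPX)) //.
    apply: pnat_coprime (pHall_pgroup sylP) _; rewrite pnatE //.
    by rewrite !inE eq_sym.
  rewrite -(@Gauss_dvdr _ p) ?(dvdn_trans (cardSg sQX)) //.
  by apply: pnat_coprime (pHall_pgroup sylQ) _; rewrite pnatE // !inE.
rewrite -defX cyclicM ?(cycS p P) ?(cycS q Q) //.
apply/commG1P/trivgP; rewrite -(coprime_TIg cop) setIC commg_subI // subsetI subxx.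
  by rewrite (subset_trans sQX) ?normal_norm.
by rewrite (subset_trans sPX) ?normal_norm.
Qed.

(** * ACLT groups of order p^m, p^2 q and p q *)

(** A normal subgroup [N] of order [p ^ 2] is abelian and its centraliser has
    index at most [p]; an element of the centraliser outside [N] then enlarges
    [N] to an abelian subgroup of order at least [p ^ 3]. *)
Lemma p4group_abelian_p3 (gT : finGroupType) (G : {group gT}) p :
  prime p -> #|G| = (p ^ 4)%N ->
  exists B : {group gT}, [/\ B \subset G, abelian B & p ^ 3 %| #|B|].
Proof.
move=> pr_p oG; have pG : p.-group G by rewrite /pgroup oG pnatX pnat_id.
have [|N [sNG nsNG oN]] := @normal_pgroup p _ 2 G G pG (normal_refl G).
  by rewrite oG pfactorK.
have lN : logn p #|N| = 2 by rewrite oN pfactorK.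
have cNN : abelian N by apply: (p2group_abelian (pgroupS sNG pG)); rewrite lN.
have pNC : p ^ 3 %| #|'C_G(N)|.
  have [sNZ | /subsetPn[x Nx notZx]] := boolP (N \subset 'Z(G)).
    rewrite (setIidPl _) ?oG ?dvdn_exp2l // centsC.
    exact: subset_trans sNZ (subsetIr _ _).
  (* The centraliser in [N] of ['C_G[x]] contains [N :&: 'Z(G)], which is not
     trivial, and [x], so its order is more than [p]. *)
  have NC : N \subset 'C_N('C_G[x]).
    have sCN : 'C_N('C_G[x]) \subset N by apply: subsetIl.
    have pN := pgroupS sNG pG.
    rewrite -[_ \subset _]negbK; apply/negP=> not_sNC.
    have ltCN : logn p #|'C_N('C_G[x])| < 2.
      rewrite -lN.
      by apply: (properG_ltn_log pN); rewrite properE sCN.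
    have ntZN : N :&: 'Z(G) != 1.
      apply: (meet_center_nil (pgroup_nil pG) nsNG).
      by rewrite -cardG_gt1 oN (ltn_exp2l 0) // prime_gt1.
    have lt1Z : 0 < logn p #|N :&: 'Z(G)|.
      rewrite -(logn1 p) -(@cards1 gT 1).
      apply: (@properG_ltn_log _ _ (N :&: 'Z(G))%G 1%G); last by rewrite proper1G.
      exact: pgroupS (subsetIl _ _) pN.
    have ltZC : logn p #|N :&: 'Z(G)| < logn p #|'C_N('C_G[x])|.
      apply: (@properG_ltn_log _ _ 'C_N('C_G[x])%G (N :&: 'Z(G))%G).
        exact: pgroupS sCN pN.
      rewrite /= properE setIS //=; last first.
        by rewrite (subset_trans (subsetIr _ _)) // centS // subsetIl.
      apply/subsetPn; exists x; last by rewrite inE (negPf notZx) andbF.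
      by rewrite inE Nx -sub1set centsC cent_set1 subsetIr.
    by move: ltCN; rewrite ltnNge (leq_trans _ ltZC).
  (* The class of [x] is contained in [N] and misses 1, and its size is a power
     of [p]. *)
  have ixG : #|G : 'C_G[x]| %| p.
    have : #|G : 'C_G[x]| %| p ^ 4 by rewrite -oG dvdn_indexg.
    case/(dvdn_pfactor _ _ pr_p)=> i _ oi.
    suffices i_le1 : i <= 1 by rewrite oi (dvdn_exp2l p i_le1).
    rewrite -ltnS -(ltn_exp2l _ _ (prime_gt1 pr_p)) -oi index_cent1 -oN.
    apply: proper_card; rewrite properE class_sub_norm ?normal_norm // Nx /=.
    apply/subsetPn; exists 1; rewrite ?group1 //.
    apply: contra notZx; rewrite class_sym class1G inE => /eqP->.
    exact: group1.
  have sCC : 'C_G[x] \subset 'C_G(N).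
    by rewrite subsetI subsetIl centsC (subset_trans NC) ?subsetIr.
  apply: dvdn_trans (cardSg sCC).
  rewrite -(dvdn_pmul2r (prime_gt0 pr_p)) -expnSr -oG.
  by rewrite -(Lagrange (subsetIl G 'C[x])) dvdn_pmul2l.
have /subsetPn[y /setIP[Gy cNy] notNy] : ~~ ('C_G(N) \subset N).
  apply: contraL (pNC) => /subset_leq_card; rewrite oN => leCN.
  rewrite gtnNdvd ?cardG_gt0 // (leq_ltn_trans leCN) //.
  by rewrite ltn_exp2l ?prime_gt1.
have sBG : N <*> <[y]> \subset G by rewrite join_subG sNG cycle_subG.
exists (N <*> <[y]>)%G; split=> //.
  by rewrite abelianY cNN cycle_abelian cycle_subG.
rewrite (card_pgroup (pgroupS sBG pG)) dvdn_exp2l // -lN.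
apply: (properG_ltn_log (pgroupS sBG pG)).
rewrite properE joing_subl; apply: contra notNy => /subsetP->//.
by rewrite mem_gen // inE cycle_id orbT.
Qed.

Lemma aclt_p_group (gT : finGroupType) (G : {group gT}) p m :
  prime p -> m <= 4 -> #|G| = (p ^ m)%N -> aclt_group G.
Proof.
move=> pr_p m_le4 oG; have pG : p.-group G by rewrite /pgroup oG pnatX pnat_id.
apply/aclt_groupP=> r pr_r; rewrite {1}oG Euclid_dvdX // dvdn_prime2 //.
case/andP=> /eqP-> m_gt0.
suffices [B [sBG cBB pB]] : exists B : {group gT},
    [/\ B \subset G, abelian B & p ^ m.-1 %| #|B|].
  have [A sAB oA] := abelian_subgroup_of_order cBB pB.
  exists A; split; [exact: subset_trans sBG | exact: abelianS cBB |].
  rewrite -divgS ?(subset_trans sAB) // oA oG -{1}(prednK m_gt0) expnS.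
  by rewrite mulnK ?expn_gt0 ?prime_gt0.
move: m_le4; rewrite leq_eqVlt => /predU1P[m4 | m_lt4].
  by rewrite m4 in oG *; apply: p4group_abelian_p3.
have [|N [sNG _ oN]] := @normal_pgroup p _ m.-1 G G pG (normal_refl G).
  by rewrite oG pfactorK // leq_pred.
exists N; rewrite oN; split=> //.
apply: (p2group_abelian (pgroupS sNG pG)); rewrite oN pfactorK //.
by rewrite -ltnS prednK.
Qed.

(** Conjugation embeds ['N_G(Q) / 'C_G(Q)] in [Aut Q], of order [#|Q| - 1]. *)
Lemma cent_prime_index (gT : finGroupType) (G Q : {group gT}) :
  Q <| G -> prime #|Q| -> #|G : 'C_G(Q)| %| #|Q| - 1.
Proof.
move=> nsQG pr_Q; have nQG := normal_norm nsQG.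
have oA : #|Aut Q| = #|Q| - 1.
  by rewrite card_Aut_cyclic ?prime_cyclic // totient_prime // subn1.
rewrite indexgI -oA.
have := cardSg (Aut_conj_aut Q G).
by rewrite card_morphim ker_conj_aut (setIidPr nQG).
Qed.

(** The number of Sylow [q]-subgroups is 1, [p] or [p ^ 2], and is 1 modulo [q].
    It is not [p], since [p < q]; if it is [p ^ 2], then [q] divides
    [(p - 1) * (p + 1)], so [q = p + 1], and 2 and 3 are the only consecutive
    primes, which leaves only the order 12. *)
Lemma normal_Sylow_p2q (gT : finGroupType) (G Q : {group gT}) p q :
  prime p -> prime q -> p < q -> #|G| = (p ^ 2 * q)%N -> #|G| <> 12 ->
  q.-Sylow(G) Q -> Q <| G.
Proof.
move=> pr_p pr_q lt_pq oG n12 sylQ.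
have k_q := card_Syl_mod G pr_q; have k_dv := card_Syl_dvd q G.
set k := #|'Syl_q(G)| in k_q k_dv.
have cokq : coprime k q.
  by rewrite coprime_sym prime_coprime // /dvdn k_q.
have : k %| p ^ 2 by rewrite -(Gauss_dvdl _ cokq) -oG.
have k1_ok : k = 1%N -> Q <| G.
  move/eqP; rewrite /k (card_Syl sylQ) indexg_eq1 subsetI subxx /= => nQ.
  by rewrite /normal (pHall_sub sylQ).
case/(dvdn_pfactor _ _ pr_p)=> [[|[|[|//]]]] _ ok; first exact: k1_ok.
  by move: k_q (prime_gt1 pr_p); rewrite ok modn_small // expn1 => ->.
case: n12; have q_dv : q %| p ^ 2 - 1.
  by rewrite -eqn_mod_dvd ?expn_gt0 ?prime_gt0 // -ok k_q modn_small ?prime_gt1.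
have : q %| (p - 1) * (p + 1) by rewrite -subn_sqr in q_dv *.
rewrite Euclid_dvdM // => /orP[q_p1 | q_p1].
  have := dvdn_leq _ q_p1; rewrite subn_gt0 prime_gt1 // => /(_ isT).
  by rewrite leqNgt (leq_ltn_trans (leq_subr _ _)).
have defq : q = p.+1.
  by apply/eqP; rewrite eqn_leq lt_pq andbT; have := dvdn_leq _ q_p1; rewrite addn1 => ->.
case: (even_prime pr_p) => [p2 | odd_p].
  by rewrite oG defq p2.
case: (even_prime pr_q) => [q2 | ].
  by move: (prime_gt1 pr_p); rewrite -ltnS -defq q2.
by rewrite defq /= odd_p.
Qed.

(** The index of the centraliser of the normal Sylow [q]-subgroup divides
    [p ^ 2] and [q - 1], hence [p]. So some element of order [p] centralises this
    Sylow subgroup, and they generate an abelian subgroup of index [p]. A Sylow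
    [p]-subgroup, of order [p ^ 2], is abelian of index [q]. *)
Lemma aclt_p2q (gT : finGroupType) (G : {group gT}) p q :
  prime p -> prime q -> p %| q - 1 -> ~~ (p ^ 2 %| q - 1) ->
  #|G| = (p ^ 2 * q)%N -> #|G| <> 12 -> aclt_group G.
Proof.
move=> pr_p pr_q p_q1 p2_q1 oG n12.
have lt_pq := dvd_pred_prime_ltn pr_p pr_q p_q1.
have neq_pq : p != q by rewrite ltn_eqF.
have [P sylP] := Sylow_exists p G; have [Q sylQ] := Sylow_exists q G.
have oP : #|P| = (p ^ 2)%N.
  rewrite (card_Hall sylP) oG partnM ?expn_gt0 ?prime_gt0 //.
  rewrite part_pnat_id ?pnatX ?pnat_id // part_p'nat ?muln1 //.
  by rewrite pnatE // !inE eq_sym.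
have oQ : #|Q| = q.
  rewrite (card_Hall sylQ) oG partnM ?expn_gt0 ?prime_gt0 //.
  rewrite part_p'nat ?mul1n ?part_pnat_id ?pnat_id //.
  by rewrite pnatX pnatE // !inE neq_pq.
have sQG := pHall_sub sylQ; have sPG := pHall_sub sylP.
apply/aclt_groupP=> r pr_r; rewrite {1}oG Euclid_dvdM // Euclid_dvdX // andbT.
rewrite !dvdn_prime2 // => /orP[]/eqP->{r pr_r}; last first.
  exists P; split=> //; last by rewrite -divgS // oP oG mulKn ?expn_gt0 ?prime_gt0.
  by apply: (p2group_abelian (pHall_pgroup sylP)); rewrite oP pfactorK.
have nsQG := normal_Sylow_p2q pr_p pr_q lt_pq oG n12 sylQ.
have cQQ : abelian Q by apply/cyclic_abelian/prime_cyclic; rewrite oQ.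
have := cent_prime_index nsQG; rewrite oQ => /(_ pr_q) iC_q1.
have sQC : Q \subset 'C_G(Q) by rewrite subsetI sQG.
have iC_p2 : #|G : 'C_G(Q)| %| p ^ 2.
  have <- : #|G : Q| = (p ^ 2)%N by rewrite -divgS // oG oQ mulnK ?prime_gt0.
  exact: indexgS.
have iC_p : #|G : 'C_G(Q)| %| p.
  case/(dvdn_pfactor _ _ pr_p): iC_p2 iC_q1 => [[|[|[|//]]]] _ -> //.
  by rewrite (negPf p2_q1).
have pC : p %| #|'C_G(Q)|.
  rewrite -(dvdn_pmul2r (prime_gt0 pr_p)).
  apply: dvdn_trans (_ : #|G| %| _); first by rewrite oG dvdn_mulr.
  by rewrite -(Lagrange (subsetIl G 'C(Q))) dvdn_pmul2l.
have [x /setIP[Gx cQx] ox] := Cauchy pr_p pC.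
have sBG : Q <*> <[x]> \subset G by rewrite join_subG sQG cycle_subG.
exists (Q <*> <[x]>)%G; split=> //.
  by rewrite abelianY cQQ cycle_abelian cycle_subG.
rewrite -divgS //= cent_joinEr ?cycle_subG // coprime_cardMg -?orderE ?ox oQ.
  by rewrite oG expnS expn1 -mulnA [(q * p)%N]mulnC mulnK // muln_gt0 !prime_gt0.
by rewrite coprime_sym prime_coprime // dvdn_prime2.
Qed.

Lemma aclt_pq (gT : finGroupType) (G : {group gT}) p q :
  prime p -> prime q -> #|G| = (p * q)%N -> aclt_group G.
Proof.
move=> pr_p pr_q oG; apply/aclt_groupP=> r pr_r r_dv.
have pr_G : prime (#|G| %/ r).
  move: r_dv; rewrite oG Euclid_dvdM // !dvdn_prime2 //.
  by case/orP=> /eqP->; rewrite ?mulKn ?mulnK ?prime_gt0.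
have [x Gx ox] := Cauchy pr_G (dvdn_div r_dv).
exists <[x]>%G; split; rewrite /= ?cycle_subG ?cycle_abelian //.
rewrite -divgS ?cycle_subG // -orderE ox.
by rewrite divnA // mulKn // cardG_gt0.
Qed.

(** * ACLT numbers with at least two prime factors *)

(** Each condition comes from a group [H] of order dividing [n] whose central
    index does not divide [p * q]. *)
Lemma aclt_number_paqb p q a b (n := (p ^ a * q ^ b)%N) :
  prime p -> prime q -> 0 < a -> 0 < b -> p %| q - 1 -> aclt_number n ->
  n = (p * q)%N \/ [/\ ~~ (p ^ 2 %| q - 1), n = (p ^ 2 * q)%N & n <> 12].
Proof.
move=> pr_p pr_q a_gt0 b_gt0 p_q1 acltn.
have lt_pq := dvd_pred_prime_ltn pr_p pr_q p_q1.
have neq_pq : p != q by rewrite ltn_eqF.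
have [p_gt0 q_gt0] := (prime_gt0 pr_p, prime_gt0 pr_q).
have n_gt0 : 0 < n by rewrite muln_gt0 !expn_gt0 p_gt0 q_gt0.
have dvd_n i j : i <= a -> j <= b -> (p ^ i * q ^ j)%N %| n.
  by move=> le_ia le_jb; rewrite dvdn_mul ?dvdn_exp2l.
have p_n : p %| n by have := dvd_n 1%N 0%N a_gt0 isT; rewrite muln1.
have q_n : q %| n by have := dvd_n 0%N 1%N isT b_gt0; rewrite mul1n.
have index_dv gT (H : {group gT}) : #|H| %| n -> #|H : 'Z(H)| %| p * q.
  by move=> Hn; apply: (aclt_number_center_index n_gt0) acltn.
have affine_le k u : 0 < k -> 1 < u -> u %| (q ^ k).-1 -> (q ^ k * u)%N %| n ->
    (q ^ k * u)%N %| p * q.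
  move=> k_gt0 u_gt1 u_dv ku_n.
  have [gT [H [oH ZH]]] := affine_centerless pr_q k_gt0 u_gt1 u_dv.
  by have := index_dv gT H; rewrite ZH indexg1 oH; apply.
have b1 : b = 1%N.
  apply/eqP; rewrite eqn_leq b_gt0 andbT leqNgt; apply/negP=> b_gt1.
  have : (q ^ 2 * p)%N %| p * q.
    apply: affine_le; rewrite ?prime_gt1 //; last by rewrite mulnC -{1}(expn1 p) dvd_n.
    apply: dvdn_trans p_q1 _; rewrite -subn1 -(exp1n 2) subn_sqr exp1n.
    exact: dvdn_mulr.
  by rewrite mulnC dvdn_pmul2l // -[X in _ %| X]expn1 (dvdn_Pexp2l _ _ (prime_gt1 pr_q)).
have a_le2 : a <= 2.
  rewrite leqNgt; apply/negP=> a_gt2.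
  have esE := pX1p2_extraspecial pr_p.
  have := index_dv _ (p^{1+2})%G.
  rewrite card_pX1p2 // -{1}[(p ^ 3)%N]muln1 -(expn0 q) dvd_n // => /(_ isT).
  rewrite -divgS ?center_sub // (card_center_extraspecial (pX1p2_pgroup pr_p) esE).
  rewrite card_pX1p2 // expnS mulKn // expnS expn1 dvdn_pmul2l //.
  by rewrite dvdn_prime2 // (negPf neq_pq).
have /orP[/eqP a1 | /eqP a2] : (a == 1%N) || (a == 2).
  by case: a a_gt0 a_le2 {acltn n_gt0 dvd_n p_n q_n index_dv affine_le n} => [|[|[]]].
  by left; rewrite /n a1 b1 !expn1.
have def_n : n = (p ^ 2 * q)%N by rewrite /n a2 b1 expn1.
right; split=> //.
  apply/negP=> p2_q1; have : (q ^ 1 * p ^ 2)%N %| p * q.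
    apply: affine_le => //; last by rewrite mulnC dvd_n // a2.
      by rewrite (ltn_exp2l 0) // prime_gt1.
    by rewrite expn1 -subn1.
  by rewrite expn1 mulnC dvdn_pmul2r // -[X in _ %| X]expn1 (dvdn_Pexp2l _ _ (prime_gt1 pr_p)).
move=> n12.
(* The field of order 4 and its unit group of order 3: 12 does not divide 6. *)
have [gT [H [oH ZH]]] := @affine_centerless 2 2 3 isT isT isT isT.
have := @aclt_number_center_index n 2 3 gT H n_gt0 isT isT isT.
rewrite ZH indexg1 oH n12; move/(_ isT isT isT); rewrite -n12 => /(_ acltn).
by [].
Qed.

Lemma center_index_dvd_prime_abelian (gT : finGroupType) (G : {group gT}) p :
  prime p -> #|G : 'Z(G)| %| p -> abelian G.
Proof.
move=> pr_p iZ; apply: cyclic_center_factor_abelian.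
have oGZ : #|G / 'Z(G)| = #|G : 'Z(G)| by rewrite card_quotient ?normal_norm ?center_normal.
case/primeP: (pr_p) => _ dv_p; have /orP[/eqP i1 | /eqP ip] := dv_p _ iZ.
  have -> : G / 'Z(G) = 1 by apply: card1_trivg; rewrite oGZ.
  exact: cyclic1.
by rewrite prime_cyclic // oGZ ip.
Qed.

(** The index of the centre divides the gcd of [p * q] and [p * r], which is [p]. *)
Lemma aclt_number_three_primes n p q r :
  prime p -> prime q -> prime r -> uniq [:: p; q; r] ->
  p %| n -> q %| n -> r %| n -> aclt_number n -> abelian_number n.
Proof.
move=> pr_p pr_q pr_r /=; rewrite !inE negb_or andbT => /andP[/andP[npq npr] nqr].
move=> p_n q_n r_n acltn gT G oG; apply: (center_index_dvd_prime_abelian pr_p).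
have iZ_pq : #|G : 'Z(G)| %| p * q.
  by apply: aclt_center_index (acltn _ _ oG); rewrite ?oG.
have iZ_pr : #|G : 'Z(G)| %| p * r.
  by apply: aclt_center_index (acltn _ _ oG); rewrite ?oG.
have := dvdn_gcd #|G : 'Z(G)| (p * q) (p * r); rewrite iZ_pq iZ_pr -muln_gcdr.
by rewrite (eqP (_ : coprime q r)) ?muln1 // prime_coprime // dvdn_prime2.
Qed.

Lemma aclt_number_two_primes n p q :
  prime p -> prime q -> p != q -> p %| n -> q %| n ->
  ~~ (p %| q - 1) -> ~~ (q %| p - 1) -> aclt_number n -> abelian_number n.
Proof.
move=> pr_p pr_q neq_pq p_n q_n npq nqp acltn gT G oG.
apply/cyclic_center_factor_abelian/(cyclic_dvd_pq pr_p pr_q neq_pq _ npq nqp).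
rewrite card_quotient ?normal_norm ?center_normal //.
by apply: aclt_center_index (acltn _ _ oG); rewrite ?oG.
Qed.

Close Scope group_scope.

Theorem theorem1p1 (n : nat) (n_gt0 : 0 < n) :
  aclt_number n <->
  [\/ abelian_number n,
      exists p q : nat,
        [/\ prime p, prime q, p < q, p %| q - 1 & n = p * q],
      exists p m : nat, [/\ prime p, m <= 4 & n = p ^ m]
    | (exists p q : nat,
        [/\ prime p, prime q & p <> q] /\
        [/\ p %| q - 1, ~~ (p ^ 2 %| q - 1) & n = p ^ 2 * q]) /\
      n <> 12].
Proof.
split=> [acltn | ]; last first.
  case=> [abn | [p [q [pr_p pr_q _ _ def_n]]] | [p [m [pr_p m_le4 def_n]]] |].
  - move=> gT G oG d dG _; have cGG := abn gT G oG.
    have [A sAG oA] := abelian_subgroup_of_order cGG dG.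
    by exists A; split=> //; apply: abelianS cGG.
  - by move=> gT G oG; apply: (aclt_pq pr_p pr_q); rewrite oG.
  - by move=> gT G oG; apply: (aclt_p_group pr_p m_le4); rewrite oG.
  - case=> [[p [q [[pr_p pr_q _] [p_q1 p2_q1 def_n]]]] n12] gT G oG.
    by apply: (aclt_p2q pr_p pr_q p_q1 p2_q1); rewrite oG.
have [n_le1 | n_gt1] := leqP n 1.
  constructor 3; exists 2, 0; split=> //.
  by apply/eqP; rewrite eqn_leq n_le1.
have pr_p := pdiv_prime n_gt1; have p_n := pdiv_dvd n.
set p := pdiv n in pr_p p_n.
have [/p_natP[m def_n] | ] := boolP (p.-nat n).
  constructor 3; exists p, m; split=> //.
  by apply: (aclt_prime_power pr_p); rewrite -def_n.
rewrite /pnat n_gt0 /= => /allPn[q].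
rewrite mem_primes n_gt0 /= !inE => /andP[pr_q q_n]; rewrite eq_sym => neq_pq.
have [pq_n | ] := boolP ([pred r | (r == p) || (r == q)].-nat n); last first.
  rewrite /pnat n_gt0 /= => /allPn[r].
  rewrite mem_primes n_gt0 /= !inE negb_or => /andP[pr_r r_n] /andP[neq_rp neq_rq].
  constructor 1; apply: (@aclt_number_three_primes n p q r) acltn => //=.
  by rewrite !inE negb_or neq_pq eq_sym neq_rp eq_sym neq_rq.
have def_n : n = p ^ logn p n * q ^ logn q n.
  rewrite -!p_part -[LHS](partnC p n_gt0); congr muln; apply: eq_in_partn => r.
  case/andP: pq_n => _ /allP pq_n /pq_n /orP[]/eqP->; rewrite !inE ?eqxx.
    by rewrite (negPf neq_pq).
  by rewrite eq_sym neq_pq.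
have [a_gt0 b_gt0] : 0 < logn p n /\ 0 < logn q n.
  by rewrite !logn_gt0 !mem_primes n_gt0 pr_p pr_q p_n q_n.
have [[r [s [[pr_r pr_s] [r_gt0 s_gt0] def_rs r_s1]]] | [np_q1 nq_p1]] :
    (exists r s, [/\ prime r /\ prime s, 0 < logn r n /\ 0 < logn s n,
       n = r ^ logn r n * s ^ logn s n & r %| s - 1])
    \/ ~~ (p %| q - 1) /\ ~~ (q %| p - 1).
- have [p_q1 | np_q1] := boolP (p %| q - 1); first by left; exists p, q.
  have [q_p1 | nq_p1] := boolP (q %| p - 1); last by right.
  by left; exists q, p; split=> //; rewrite mulnC.
- have lt_rs := dvd_pred_prime_ltn pr_r pr_s r_s1.
  have := aclt_number_paqb pr_r pr_s r_gt0 s_gt0 r_s1.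
  rewrite -def_rs => /(_ acltn)[def_n' | [r2_s1 def_n' n12]].
    by constructor 2; exists r, s.
  constructor 4; split=> //; exists r, s; split=> //; split=> //.
  by move=> eq_rs; rewrite eq_rs ltnn in lt_rs.
constructor 1; exact: aclt_number_two_primes neq_pq p_n q_n np_q1 nq_p1 acltn.
Qed.
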